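(* Let $F\subseteq\mathbb{R}$ be the attractor of an IFS $\Phi$ of homotheties of $\mathbb{R}$. Assume that $\dim_{\mathrm H}(F)<1$ and that $F$ is not a singleton. Then $F$ is weakly homogeneous if and only if $\Phi$ satisfies the weak separation condition (WSC).
   Context: $\dim_{\mathrm H}$ is Hausdorff dimension and $Q=[0,1]\subseteq\mathbb{R}$. A homothety of $\mathbb{R}$ is a map $x\mapsto rx+\alpha$ with $r>0$, $\alpha\in\mathbb{R}$; it is contracting if $r<1$ and expanding if $r\ge1$. For a compact $F\subseteq\mathbb{R}$, an F-miniset of $F$ is a non-empty compact subset of a set of the form $Q\cap\varphi(F)$ with $\varphi$ an expanding homothety; an F-microset of $F$ is any limit of F-minisets of $F$ in the Hausdorff metric. $F$ is weakly homogeneous if every F-microset of $F$ is a union of finitely many F-minisets of $F$. An IFS of homotheties is a finite non-empty collection $\Phi=\{\varphi_i\}_{i\in\Lambda}$ of contracting homotheties with ratios $r_i$; its attractor is the unique non-empty compact set $F$ with $F=\bigcup_{i\in\Lambda}\varphi_i(F)$. For a finite word $i=i_1\dots i_k$ over $\Lambda$ put $\varphi_i=\varphi_{i_1}\circ\dots\circ\varphi_{i_k}$, $r_i=r_{i_1}\cdots r_{i_k}$. For $\rho>0$ let $\Pi_\rho$ be the set of non-empty finite words $i$ with $r_i\le\rho<r_{i_1}\cdots r_{i_{|i|-1}}$ (empty product equal to $1$). $\Phi$ satisfies the WSC if there is $c\in\mathbb{N}$ such that for every $\rho>0$ and every ball $B$ of radius $\rho$, $|\{\varphi_i(F): i\in\Pi_\rho,\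 \varphi_i(F)\cap B\ne\emptyset\}|\le c$, where identical sets $\varphi_i(F)=\varphi_j(F)$ with $i\neq j$ are counted only once. *)

(* Defs.v *)
From HB Require Import structures.
From mathcomp Require Import all_boot all_order all_algebra.
From mathcomp Require Import all_classical all_reals all_analysis.

Set Implicit Arguments.
Unset Strict Implicit.
Unset Printing Implicit Defensive.

Import Order.TTheory GRing.Theory Num.Theory numFieldNormedType.Exports.

Local Open Scope classical_set_scope.
Local Open Scope ring_scope.

Section HausdorffDimension.
Variable R : realType.
Implicit Types U E : set R.

(* Equals -oo on the empty set, which [hcontent] treats separately. *)
Definition ediam U : \bar R :=
  ereal_sup [set (`|xy.1 - xy.2|)%:E | xy in U `*` U].

(* [diam(U)^s], with [diam(set0)^s = 0] for every [s] (including [s = 0]) and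
   [diam([set x])^0 = 1], so that the 0-dimensional measure counts points. *)
Definition hcontent (s : R) U : \bar R :=
  if U == set0 then 0%E else poweR (ediam U) s.

Definition hausdorff_premeasure (s d : R) E : \bar R :=
  ereal_inf [set (\sum_(0 <= i <oo) hcontent s (U_ i))%E | U_ in
    [set U_ : nat -> set R | E `<=` \bigcup_i U_ i /\
                             forall i, (ediam (U_ i) <= d%:E)%E]].

Definition hausdorff_measure (s : R) E : \bar R :=
  ereal_sup [set hausdorff_premeasure s d E | d in [set d : R | 0 < d]].

Definition hausdorff_dim E : \bar R :=
  ereal_inf [set s%:E | s in [set s : R | 0 <= s /\ hausdorff_measure s E = 0%E]].

End HausdorffDimension.

Section HausdorffMetric.
Variable R : realType.
Implicit Types A B : set R.

Definition point_dist (x : R) A : \bar R := ereal_inf [set (`|x - y|)%:E | y in A].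

Definition hausdorff_dist A B : \bar R :=
  maxe (ereal_sup [set point_dist a B | a in A])
       (ereal_sup [set point_dist b A | b in B]).

End HausdorffMetric.

Record homothety (R : realType) := Homothety {
  ratio : R;
  shift : R;
  ratio_gt0 : 0 < ratio }.

Definition homothety_fun (R : realType) (phi : homothety R) (x : R) : R :=
  ratio phi * x + shift phi.
Coercion homothety_fun : homothety >-> Funclass.

Definition contracting (R : realType) (phi : homothety R) := ratio phi < 1.
Definition expanding (R : realType) (phi : homothety R) := 1 <= ratio phi.

Section Microsets.
Variable R : realType.
Implicit Types F M K : set R.

Definition miniset F M := [/\ compact M, M !=set0 &
  exists phi : homothety R, expanding phi /\ M `<=` `[0, 1] `&` phi @` F].

(* The limit is taken in the space of non-empty compact sets, on which
   [hausdorff_dist] is a metric. *)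
Definition microset F K := [/\ compact K, K !=set0 &
  exists M_ : nat -> set R, (forall n, miniset F (M_ n)) /\
    hausdorff_dist (M_ n) K @[n --> \oo] --> 0%E].

Definition weakly_homogeneous F := forall K, microset F K ->
  exists (n : nat) (M_ : 'I_n -> set R),
    (forall i, miniset F (M_ i)) /\ K = \bigcup_i M_ i.

End Microsets.

Section IFS.
Variables (R : realType) (L : finType) (Phi : L -> homothety R).
Implicit Types (w : seq L) (F : set R).

Definition is_ifs := (0 < #|L|)%N /\ forall i, contracting (Phi i).

Definition attractor F :=
  [/\ compact F, F !=set0 & F = \bigcup_(i in [set: L]) (Phi i @` F)].

Definition word_map w : R -> R := foldr (fun i f => Phi i \o f) id w.

Definition word_ratio w : R := \prod_(i <- w) ratio (Phi i).

(* [take (size w).-1 w] is [w] without its last letter. *)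
Definition stopping_words (rho : R) : set (seq L) :=
  [set w | [/\ w != [::], word_ratio w <= rho &
               rho < word_ratio (take (size w).-1 w)]].

(* The counted family is a set of subsets of [R], so words with the same image
   of [F] contribute once. [ball] is open; closed balls only change [c]. *)
Definition weak_separation F := exists c : nat, forall (rho x : R), 0 < rho ->
  ([set word_map w @` F | w in [set w | stopping_words rho w /\
      (word_map w @` F) `&` ball x rho !=set0]] #<= `I_c)%card.

End IFS.

(* Main.v *)
(* Under the WSC, the part of F seen through a window of size 1/s is covered by
   boundedly many copies of F of size comparable to 1/s. Rescaling, any miniset
   is covered by a bounded number of images psi(F) with ratios in a fixed
   compact interval, and such covers pass to Hausdorff limits.

   Without the WSC, the pigeonhole principle gives words p <> q whose maps are
   relatively as close as desired on F. The end points of F are fixed points of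
   maps of the IFS, so F is mapped into itself by arbitrarily strong contractions
   towards them. At an end point e where |q - p| is maximal, contract an almost
   arithmetic progression of F towards e until its gaps are comparable to
   |q(e) - p(e)|; its image under p, together with the image under q of its last
   point, is an almost arithmetic progression with one more point. Hence [0, 1]
   is a microset of F; it is not a finite union of minisets, because
   dim_H F < 1 makes F a Lebesgue null set. *)
From mathcomp Require Import all_boot all_order all_algebra.
From mathcomp Require Import all_classical all_reals all_analysis.
From mathcomp Require Import ring lra.
Require Import Defs.

Set Implicit Arguments.
Unset Strict Implicit.
Unset Printing Implicit Defensive.

Import Order.TTheory GRing.Theory Num.Theory numFieldNormedType.Exports.

Local Open Scope classical_set_scope.
Local Open Scope ring_scope.

(** * Homotheties and almost arithmetic progressions *)

Section Homotheties.
Variable R : realType.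
Implicit Types p q : homothety R.

Lemma homothety_sub p y z : p y - p z = ratio p * (y - z).
Proof. by rewrite /homothety_fun; ring. Qed.

Lemma homothety_diffE p q a b y :
  (q y - p y) * (b - a) = (q a - p a) * (b - y) + (q b - p b) * (y - a).
Proof. by rewrite /homothety_fun; ring. Qed.

(** As [q - p] is affine, its value at [y] is a convex combination of its values at [a] and [b].
    Maps thus need to be compared only at the end points of [F]. *)
Lemma homothety_dist_le p q a b M y : a < b -> a <= y <= b ->
  `|q a - p a| <= M -> `|q b - p b| <= M -> `|q y - p y| <= M.
Proof.
move=> ab /andP[ay yb] /ler_normlP[? ?] /ler_normlP[? ?].
have ba : 0 < b - a by rewrite subr_gt0.
rewrite -(ler_pM2r ba) -{1}(gtr0_norm ba) -normrM homothety_diffE.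
have -> : M * (b - a) = M * (b - y) + M * (y - a) by ring.
apply: (le_trans (ler_normD _ _)); rewrite !normrM.
rewrite (ger0_norm (_ : 0 <= b - y)) ?subr_ge0//.
rewrite (ger0_norm (_ : 0 <= y - a)) ?subr_ge0//.
by rewrite lerD// ler_wpM2r ?subr_ge0// ler_norml; apply/andP; split; lra.
Qed.

Lemma homothety_eq2 p q a b : a != b -> p a = q a -> p b = q b ->
  p = q :> (R -> R).
Proof.
move=> ab pqa pqb; apply/funext => y; apply/esym/subr0_eq.
have /eqP := homothety_diffE p q a b y.
rewrite pqa pqb !subrr !mul0r addr0 mulf_eq0 => /orP[/eqP//|].
by rewrite subr_eq0 eq_sym (negPf ab).
Qed.

End Homotheties.

Section Progressions.
Variables (R : realType) (F : set R).
Implicit Types (p q : homothety R) (x : nat -> R) (e r kappa beta : R).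

(** [kappa] stays fixed while the number [N] of gaps grows, so that each gap is at most the fraction
    [1 / (kappa * N)] of the total length. *)
Definition near_progression kappa N x beta :=
  [/\ 0 < beta, forall k, (k <= N)%N -> F (x k) &
      forall k, (k < N)%N -> kappa * beta <= x k.+1 - x k <= beta].

(* The new progression is the image under [p] of [x] contracted towards [e],
   followed by the image under [q] of the last contracted point. *)
Lemma near_progression_step kappa N x beta e r m0 p q :
  0 < r -> (forall m y, F y -> F (e + r ^+ m * (y - e))) ->
  (forall y, F y -> F (p y)) -> (forall y, F y -> F (q y)) ->
  F e -> p e < q e -> (forall y, F y -> `|q y - p y| <= q e - p e) ->
  kappa <= r / 2 -> r < 1 -> r ^+ m0 <= 1 / 4 ->
  q e - p e <= r ^+ m0 * (beta * ratio p) ->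
  near_progression kappa N x beta ->
  exists x' beta', near_progression kappa N.+1 x' beta'.
Proof.
move=> r0 Fe Fp Fq ein lt_pq le_pq kr r1 rm0 small [b0 xF xgap].
set S := q e - p e in le_pq small; have S0 : 0 < S by rewrite subr_gt0.
set A := beta * ratio p in small; have A0 : 0 < A by rewrite mulr_gt0 ?ratio_gt0.
(* [A] bounds the gaps of the image of [x] under [p]. Stepping back by one from the first such
   exponent gives [r ^+ m.+1 * A < S <= r ^+ m * A]: the contracted gaps become comparable to the
   displacement [S]. *)
have : exists m, r ^+ m * A < S.
  have /cvgrPdist_lt /(_ (S / A) (divr_gt0 S0 A0)) : r ^+ n @[n --> \oo] --> 0.
    by apply: cvg_expr; rewrite gtr0_norm.
  move=> [m _ /(_ m (leqnn m))] /=; rewrite sub0r normrN gtr0_norm ?exprn_gt0//.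
  by rewrite ltr_pdivlMr// => ?; exists m.
move=> /ex_minnP[m mlt mmin].
(* By [small] the first exponent lies beyond [m0], so its predecessor is at least [m0] and contracts
   by a factor of at most 1/4. *)
have m0m : (m0 < m)%N.
  rewrite ltnNge; apply/negP => mm0.
  have : r ^+ m0 * A <= r ^+ m * A.
    by rewrite ler_wpM2r ?(ltW A0)//; apply: ler_wiXn2l; rewrite ?ltW.
  by move/(le_trans small); rewrite leNgt mlt.
case: m => // m in mlt mmin m0m *.
have mge : S <= r ^+ m * A.
  by rewrite leNgt; apply/negP => /mmin; rewrite ltnn.
have rm4 : r ^+ m <= 1 / 4.
  by apply: le_trans rm0; apply: ler_wiXn2l; rewrite ?ltW.
have rm_gt0 : 0 < r ^+ m by rewrite exprn_gt0.
pose y k := e + r ^+ m * (x k - e).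
exists (fun k => if (k <= N)%N then p (y k) else q (y N)), (r ^+ m * A); split.
- by rewrite mulr_gt0.
- move=> k _; case: leqP => kN; first exact/Fp/Fe/xF.
  exact/Fq/Fe/xF.
- move=> k; rewrite ltnS => kN /=; rewrite kN; case: (ltnP k N) => [k1N|Nk].
    rewrite homothety_sub.
    have -> : y k.+1 - y k = r ^+ m * (x k.+1 - x k) by rewrite /y; ring.
    have /andP[lo hi] := xgap _ k1N.
    have c0 : 0 < ratio p * r ^+ m by rewrite mulr_gt0 ?ratio_gt0.
    rewrite /A !mulrA; apply/andP; split.
      have -> : kappa * r ^+ m * beta * ratio p = ratio p * r ^+ m * (kappa * beta).
        by ring.
      by rewrite ler_pM2l.
    have -> : r ^+ m * beta * ratio p = ratio p * r ^+ m * beta by ring.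
    by rewrite ler_pM2l.
  have <- : k = N by apply/eqP; rewrite eqn_leq kN.
  have Fy : F (y k) by apply/Fe/xF.
  apply/andP; split; last first.
    by apply: le_trans mge; apply: le_trans (le_pq _ Fy); exact: ler_norm.
  (* Contraction towards [e] multiplies the deviation of [q - p] from [S] by [r ^+ m <= 1 / 4]. This
     deviation is at least [- 2 * S], so the last gap is at least [S / 2], and [S / 2 > r ^+ m.+1 *
     A / 2 >= kappa * (r ^+ m * A)]. *)
  have aff : q (y k) - p (y k) = S + r ^+ m * ((q (x k) - p (x k)) - S).
    by rewrite /S /y /homothety_fun; ring.
  have := le_pq _ (xF _ kN); rewrite ler_norml => /andP[Dlo _].
  rewrite aff; apply: (@le_trans _ _ (S / 2)); last first.
    have : r ^+ m * (- S - S) <= r ^+ m * (q (x k) - p (x k) - S).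
      by rewrite ler_pM2l//; lra.
    have : r ^+ m * S <= 1 / 4 * S by rewrite ler_pM2r.
    by lra.
  have : kappa * (r ^+ m * A) <= r / 2 * (r ^+ m * A).
    by rewrite ler_pM2r// mulr_gt0.
  by move: mlt; rewrite exprS; lra.
Qed.

End Progressions.

(** Induction on [N]: the closeness required of [p] and [q] depends on the [beta] already reached,
    whereas [kappa] depends only on [ra] and [rb]. Closeness is relative to both ratios because the
    two maps may have to be exchanged. *)
Lemma near_progression_exists (R : realType) (F : set R) (a b ra rb : R) :
  F a -> F b -> a < b -> (forall y, F y -> a <= y <= b) ->
  0 < ra < 1 -> 0 < rb < 1 ->
  (forall m y, F y -> F (a + ra ^+ m * (y - a))) ->
  (forall m y, F y -> F (b + rb ^+ m * (y - b))) ->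
  (forall eps : R, 0 < eps -> exists p q : homothety R,
    [/\ forall y, F y -> F (p y), forall y, F y -> F (q y),
        forall y, F y -> `|q y - p y| <= eps * ratio p,
        forall y, F y -> `|q y - p y| <= eps * ratio q &
        p <> q :> (R -> R)]) ->
  exists2 kappa, 0 < kappa &
    forall N, exists x beta, near_progression F kappa N x beta.
Proof.
move=> Fa Fb ab Fab /andP[ra0 ra1] /andP[rb0 rb1] cla clb close.
pose kappa := Num.min ra rb / 2.
have mr0 : 0 < Num.min ra rb by rewrite lt_min ra0.
exists kappa; first by rewrite divr_gt0.
elim=> [|N [x [beta prog]]].
  by exists (fun=> a), 1; split => //.
have [m0 m0a m0b] : exists2 m0, ra ^+ m0 <= 1 / 4 & rb ^+ m0 <= 1 / 4.
  have : \forall n \near \oo, ra ^+ n <= 1 / 4 /\ rb ^+ n <= 1 / 4.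
    have h (r : R) : 0 < r -> r < 1 -> \forall n \near \oo, r ^+ n <= 1 / 4.
      move=> r0 r1.
      have /cvgrPdist_le /(_ (1 / 4) ltac:(lra)) : r ^+ n @[n --> \oo] --> 0.
        by apply: cvg_expr; rewrite gtr0_norm.
      apply: filterS => n; rewrite sub0r normrN gtr0_norm ?exprn_gt0//.
    by apply: filterI; exact: h.
  by move=> [m _ /(_ m (leqnn m))[]]; exists m.
have [b0 _ _] := prog.
(* Small enough for the extension step at either end point, since [Num.min ra rb] is at most the
   ratio used there. *)
pose eps := Num.min ra rb ^+ m0 * beta.
have eps0 : 0 < eps by rewrite mulr_gt0 ?exprn_gt0.
have [p [q [Fp Fq epsp epsq pq]]] := close _ eps0.
have epsE (r t : R) : Num.min ra rb <= r -> 0 <= t ->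
    eps * t <= r ^+ m0 * (beta * t).
  move=> mr t0; rewrite /eps -mulrA ler_wpM2r ?mulr_ge0 ?(ltW b0)//.
  by rewrite lerXn2r ?nnegrE ?(ltW mr0)// (le_trans _ mr)// ltW.
have kap (r : R) : Num.min ra rb <= r -> kappa <= r / 2.
  by move=> ?; rewrite /kappa ler_pM2r.
have mra : Num.min ra rb <= ra by rewrite ge_min lexx.
have mrb : Num.min ra rb <= rb by rewrite ge_min lexx orbT.
pose D y := q y - p y.
have Dle M y : `|D a| <= M -> `|D b| <= M -> F y -> `|D y| <= M.
  by move=> Da Db /Fab aby; exact: homothety_dist_le Da Db.
have D0 : D a = 0 -> D b = 0 -> False.
  move=> /eqP + /eqP; rewrite !subr_eq0 => /eqP Da /eqP Db.
  exact/pq/(homothety_eq2 _ (esym Da) (esym Db))/negbT/lt_eqF.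
have step (e r : R) : 0 < r -> r < 1 -> r ^+ m0 <= 1 / 4 -> Num.min ra rb <= r ->
    F e -> (forall m y, F y -> F (e + r ^+ m * (y - e))) ->
    (forall y, F y -> `|D y| <= `|D e|) ->
    exists x' beta', near_progression F kappa N.+1 x' beta'.
  move=> r0 r1 rm0 mr Fe cle Dmax.
  have De0 : D e != 0.
    apply/eqP => De; have Dz y : F y -> D y = 0.
      by move=> /Dmax; rewrite De normr0 normr_le0 => /eqP.
    by apply: D0; exact: Dz.
  (* The extension step wants [p e < q e]; in the opposite case [p] and [q] swap roles. *)
  case: (ltgtP (p e) (q e)) => [lt|lt|eq]; last first.
  - by move: De0; rewrite /D eq subrr eqxx.
  - have De : `|D e| = p e - q e by rewrite distrC gtr0_norm// subr_gt0.
    apply: (@near_progression_step _ F kappa N x beta e r m0 q p) => //.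
    + by move=> y Fy; rewrite -De distrC Dmax.
    + exact: kap.
    + by rewrite -De; apply: le_trans (epsq _ Fe) (epsE _ _ mr _); exact/ltW/ratio_gt0.
  - have De : `|D e| = q e - p e by rewrite gtr0_norm// subr_gt0.
    apply: (@near_progression_step _ F kappa N x beta e r m0 p q) => //.
    + by move=> y Fy; rewrite -De Dmax.
    + exact: kap.
    + by rewrite -De; apply: le_trans (epsp _ Fe) (epsE _ _ mr _); exact/ltW/ratio_gt0.
have [ba|/ltW ba] := leP `|D b| `|D a|.
  by apply: (step a ra) => // y; exact: Dle.
by apply: (step b rb) => // y; exact: Dle.
Qed.

(** * The unit interval as a microset *)

Section HausdorffDist.
Variable R : realType.
Implicit Types A B : set R.

Lemma hausdorff_dist_le A B (eps : R) :
  (forall a, A a -> exists2 b, B b & `|a - b| <= eps) ->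
  (forall b, B b -> exists2 a, A a & `|b - a| <= eps) ->
  (hausdorff_dist A B <= eps%:E)%E.
Proof.
move=> AB BA; rewrite /hausdorff_dist ge_max; apply/andP; split.
  apply: ge_ereal_sup => _ [a Aa <-]; have [b Bb ab] := AB _ Aa.
  by apply: le_trans (_ : (`|a - b|%:E <= _)%E);
    [apply: ereal_inf_lbound; exists b | rewrite lee_fin].
apply: ge_ereal_sup => _ [b Bb <-]; have [a Aa ab] := BA _ Bb.
by apply: le_trans (_ : (`|b - a|%:E <= _)%E);
  [apply: ereal_inf_lbound; exists a | rewrite lee_fin].
Qed.

Lemma hausdorff_dist_ge0 A B : A !=set0 -> (0 <= hausdorff_dist A B)%E.
Proof.
move=> [a Aa]; rewrite /hausdorff_dist le_max; apply/orP; left.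
apply: (@le_trans _ _ (point_dist a B)).
  by apply: le_ereal_inf_tmp => _ [b _ <-]; rewrite lee_fin.
by apply: ereal_sup_ubound; exists a.
Qed.

Lemma hausdorff_dist_lt A B (eps : R) b :
  (hausdorff_dist A B < eps%:E)%E -> B b -> exists2 a, A a & `|b - a| < eps.
Proof.
rewrite /hausdorff_dist gt_max => /andP[_ lt] Bb.
have /ereal_inf_lt[_ [a Aa <-]] : (point_dist b A < eps%:E)%E.
  by apply: le_lt_trans lt; apply: ereal_sup_ubound; exists b.
by rewrite lte_fin; exists a.
Qed.

End HausdorffDist.

(** A walk from [x 0] to [x N] that rises by at most [beta] at a time cannot pass [t] without coming
    within [beta] of it. *)
Lemma near_of_small_gaps (R : realDomainType) (x : nat -> R) N beta t :
  0 <= beta -> (forall k, (k < N)%N -> x k.+1 - x k <= beta) ->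
  x 0%N <= t <= x N -> exists2 k, (k <= N)%N & `|t - x k| <= beta.
Proof.
move=> b0; elim: N => [_|N IH gap].
  rewrite -eq_le => /eqP <-; exists 0%N => //.
  by rewrite subrr normr0.
move=> /andP[xt tx].
have [tN|Nt] := leP t (x N).
  have [//||k kN xk] := IH; first by move=> k kN; exact/gap/ltnW.
    by rewrite xt.
  by exists k => //; exact: leqW.
exists N.+1 => //; rewrite distrC ger0_norm ?subr_ge0//.
by apply: le_trans (gap N (leqnn _)); rewrite lerD2l lerN2 ltW.
Qed.

(** A progression with [n.+1] gaps, normalised to run from [0] to [1], has gaps of at most
    [1 / (kappa * n.+1)], so these finite sets converge to the interval. *)
Lemma unit_interval_microset (R : realType) (F : set R) (a r kappa : R) :
  F a -> 0 < r < 1 -> (forall m y, F y -> F (a + r ^+ m * (y - a))) ->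
  0 < kappa -> (forall N, exists x beta, near_progression F kappa N x beta) ->
  microset F `[0, 1].
Proof.
move=> Fa /andP[r0 r1] cla k0 progs; split; first exact: segment_compact.
  by exists 0; rewrite /= in_itv/= lexx ler01.
have approx n : exists M, miniset F M /\
    (hausdorff_dist M `[0%R, 1%R] <= (kappa^-1 * harmonic n)%:E)%E.
  have [x [beta [b0 xF gap]]] := progs n.+1.
  have mono i j : (i <= j <= n.+1)%N -> x i <= x j.
    elim: j => [|j IH]; first by rewrite leqn0 andbC => /andP[_ /eqP ->].
    rewrite leq_eqVlt => /andP[/orP[/eqP ->//|]]; rewrite ltnS => ij jn.
    apply: le_trans (IH _) _; first by rewrite ij ltnW.
    have /andP[lo _] := gap _ jn; rewrite -subr_ge0; apply: le_trans lo.
    by rewrite mulr_ge0// ltW.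
  pose L := x n.+1 - x 0%N.
  have Lge : (n.+1)%:R * (kappa * beta) <= L.
    rewrite /L; elim: n.+1 gap => [|m IH] gap; first by rewrite mul0r subrr.
    have /IH : forall k, (k < m)%N -> kappa * beta <= x k.+1 - x k <= beta.
      by move=> k km; exact/gap/ltnW.
    by have /andP[+ _] := gap m (leqnn _); rewrite -natr1 mulrDl mul1r; lra.
  have L0 : 0 < L by apply: lt_le_trans Lge; rewrite !mulr_gt0.
  (* A miniset requires an expanding map, so the progression is first contracted towards [a], inside
     [F], to a length of at most 1. *)
  have [m mL] : exists m, r ^+ m * L <= 1.
    have /cvgrPdist_le /(_ (L^-1)) : r ^+ n @[n --> \oo] --> 0.
      by apply: cvg_expr; rewrite gtr0_norm.
    rewrite invr_gt0 => /(_ L0)[m _ /(_ m (leqnn m))] /=.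
    rewrite sub0r normrN gtr0_norm ?exprn_gt0// => h; exists m.
    by rewrite -(@ler_pM2r _ L^-1) ?invr_gt0// mulfK ?gt_eqF// mul1r.
  have rmL0 : 0 < r ^+ m * L by rewrite mulr_gt0 ?exprn_gt0.
  pose y k := a + r ^+ m * (x k - a).
  pose t k := (x k - x 0%N) / L.
  exists [set t k | k in `I_n.+2]; split; first split.
  - exact/finite_compact/finite_image/finite_II.
  - by exists (t 0%N); exists 0%N.
  - have rI : 0 < (r ^+ m * L)^-1 by rewrite invr_gt0.
    exists (Homothety (- (y 0%N) / (r ^+ m * L)) rI); split.
      by rewrite /expanding /= invf_ge1.
    move=> _ [k kn <-]; split; last first.
      exists (y k); first exact/cla/xF.
      rewrite /homothety_fun /= /t /y; field.
      by rewrite !gt_eqF ?exprn_gt0.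
    rewrite /= in_itv /= /t divr_ge0 ?(ltW L0) ?subr_ge0 ?mono//=.
    by rewrite ler_pdivrMr// mul1r lerD2r mono// -ltnS leqnn andbT.
  - apply: hausdorff_dist_le.
      move=> _ [k kn <-]; exists (t k); last first.
        by rewrite subrr normr0 mulr_ge0 ?invr_ge0 ?harmonic_ge0// ltW.
      rewrite /= in_itv /= /t divr_ge0 ?(ltW L0) ?subr_ge0 ?mono//=.
      by rewrite ler_pdivrMr// mul1r lerD2r mono// -ltnS leqnn andbT.
    move=> s /=; rewrite in_itv /= => /andP[s0 s1].
    have [|||k kn tk] := @near_of_small_gaps _ x n.+1 beta (x 0%N + s * L).
    - exact: ltW.
    - by move=> k /gap/andP[].
    - rewrite lerDl mulr_ge0 ?(ltW L0)//=.
      by rewrite -lerBrDl -/L ler_piMl// ltW.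
    exists (t k); first by exists k.
    have -> : s - t k = (x 0%N + s * L - x k) / L.
      by rewrite /t; field; rewrite gt_eqF.
    rewrite normrM normfV (gtr0_norm L0) ler_pdivrMr//.
    apply: (le_trans tk); rewrite /harmonic /=.
    have N0 : 0 < n.+1%:R :> R by rewrite ltr0n.
    move: (n.+1%:R) N0 Lge => M M0 Lge.
    have -> : beta = kappa^-1 * M^-1 * (M * (kappa * beta)).
      by field; rewrite !gt_eqF.
    by rewrite ler_pM2l// mulr_gt0 ?invr_gt0.
have [M MP] := choice approx.
exists M; split; first by move=> n; have [] := MP n.
apply: (@squeeze_cvge _ _ _ _ (fun=> 0%E) _ (fun n => (kappa^-1 * harmonic n)%:E)).
- apply: nearW => n; have [[_ M0 _] le] := MP n.
  by rewrite hausdorff_dist_ge0.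
- exact: cvg_cst.
- apply: cvg_EFin; first exact: nearW.
  rewrite -(mulr0 kappa^-1); apply: cvgMr; exact: cvg_harmonic.
Qed.

(** * Sets of dimension less than one are null *)

Section NullSets.
Variable R : realType.
Implicit Types (F K : set R) (phi : homothety R).

(** For some [s < 1] the [s]-dimensional measure vanishes. With mesh [1], each diameter [d]
    satisfies [d <= d ^ s], so a small [s]-content forces a small sum of diameters. A non-empty set
    lies in the interval about any of its points with its diameter as radius. *)
Lemma interval_cover F (eps : R) : (hausdorff_dim F < 1)%E -> 0 < eps ->
  exists x r : nat -> R, [/\ forall i, 0 <= r i,
    F `<=` \bigcup_i `[x i - r i, x i + r i]%classic &
    (\sum_(0 <= i <oo) (r i)%:E < eps%:E)%E].
Proof.
move=> /ereal_inf_lt[_ [s [s0 measF] <-]]; rewrite lte_fin => s1 eps0.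
have : (hausdorff_premeasure s 1 F < eps%:E)%E.
  apply: (@le_lt_trans _ _ 0%E); last by rewrite lte_fin.
  by rewrite -measF; apply: ereal_sup_ubound; exists 1 => //=.
move=> /ereal_inf_lt[_ [U [FU diamU] <-]] sumU.
have rad i : exists xr : R * R, [/\ 0 <= xr.2,
    U i `<=` `[xr.1 - xr.2, xr.1 + xr.2] & (xr.2%:E <= hcontent s (U i))%E].
  rewrite /hcontent; case: eqVneq => [->|/set0P[x Ux]].
    by exists (0, 0); split => //; exact: sub0set.
  have dist y z : U i y -> U i z -> (`|y - z|%:E <= ediam (U i))%E.
    by move=> ? ?; apply: ereal_sup_ubound; exists (y, z).
  have d0 : (0 <= ediam (U i))%E by have := dist x x Ux Ux; rewrite subrr normr0.
  have dfin : ediam (U i) \is a fin_num.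
    by rewrite ge0_fin_numE//; apply: le_lt_trans (diamU i) _; rewrite ltry.
  exists (x, fine (ediam (U i))); split => /=.
  - exact: fine_ge0.
  - move=> y Uy; rewrite /= in_itv /= -ler_distl -lee_fin fineK//.
    exact: dist.
  - move: d0 (diamU i); rewrite -(fineK dfin); move: (fine _) => d /=.
    rewrite !lee_fin => + d1.
    rewrite le_eqVlt => /predU1P[<-|d0]; first exact: powR_ge0.
    by apply: ger1_powR; [rewrite d0 | exact: ltW].
have [xr xrP] := choice rad.
exists (fun i => (xr i).1), (fun i => (xr i).2); split.
- by move=> i; have [] := xrP i.
- apply: (subset_trans FU) => y [i _ Uy]; exists i => //.
  by have [_ Usub _] := xrP i; exact: Usub.
- apply: le_lt_trans sumU; apply: lee_nneseries => i.
    by move=> _ _; have [? _ _] := xrP i; rewrite lee_fin.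
  by move=> _; have [] := xrP i.
Qed.

(** [phi] carries a cover of [F] by intervals to a cover of [K], multiplying lengths by its ratio;
    the factor [2] turns radii into lengths. Compactness makes [K] measurable. *)
Lemma homothety_image_null F K phi : (hausdorff_dim F < 1)%E ->
  compact K -> K `<=` phi @` F -> lebesgue_measure K = 0%E.
Proof.
move=> dimF cK KF; apply/eqP; rewrite eq_le measure_ge0 andbT.
apply/lee_addgt0Pr => e e0; rewrite add0e.
have c0 : 0 < 2 * ratio phi by rewrite mulr_gt0 ?ratio_gt0.
have [x [r [r0 Fx sumr]]] := interval_cover dimF (divr_gt0 e0 c0).
pose I i := `[phi (x i) - ratio phi * r i, phi (x i) + ratio phi * r i]%classic.
have le : (lebesgue_measure K <= \sum_(0 <= i <oo) lebesgue_measure (I i))%E.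
  apply: measure_sigma_subadditive; first by move=> i; exact: measurable_itv.
    exact: measurable_realfun.compact_measurable.
  move=> _ /KF[y /Fx[i _ yi] <-]; move: yi; rewrite /= in_itv /= => /andP[lo hi].
  exists i => //; rewrite /I /= in_itv /= /homothety_fun.
  have p0 := ratio_gt0 phi.
  move: lo hi; rewrite -(ler_pM2l p0) => lo; rewrite -(ler_pM2l p0) => hi.
  by apply/andP; split; move: lo hi; lra.
apply: (le_trans le).
apply: (@le_trans _ _ (\sum_(0 <= i <oo) (2 * ratio phi)%:E * (r i)%:E)%E).
  apply: lee_nneseries => i; first by move=> *; exact: measure_ge0.
  move=> _; rewrite lebesgue_measure_itv /= lte_fin.
  case: ifPn => _; last by rewrite lee_fin mulr_ge0// ltW.
  by rewrite -EFinB lee_fin; lra.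
rewrite nneseriesZl; last by move=> i _; rewrite lee_fin.
apply/ltW; rewrite -lte_pdivlMl//.
by apply: lt_le_trans sumr _; rewrite lee_fin mulrC.
Qed.

Lemma unit_interval_not_finite_union F n (M_ : 'I_n -> set R) :
  (hausdorff_dim F < 1)%E -> (forall i, miniset F (M_ i)) ->
  `[0, 1]%classic <> \bigcup_i M_ i.
Proof.
move=> dimF mini cover.
(* The finite family is padded with empty sets to a sequence, for countable subadditivity. *)
pose N k := if insub k is Some i then M_ i else set0.
have nullN k : lebesgue_measure (N k) = 0%E.
  rewrite /N; case: insubP => [i _ _|_]; last exact: measure0.
  have [cM _ [phi [_ MF]]] := mini i.
  by apply: (@homothety_image_null F _ phi) => // x /MF[].
have : (lebesgue_measure (`[0%R, 1%R] : set R) <=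
        \sum_(0 <= k <oo) lebesgue_measure (N k))%E.
  apply: measure_sigma_subadditive.
  - move=> k; rewrite /N; case: insubP => [i _ _|_]; last exact: measurable0.
    by have [cM _ _] := mini i; exact: measurable_realfun.compact_measurable.
  - exact: measurable_itv.
  - by rewrite cover => x [i _ Mx]; exists i => //; rewrite /N valK.
rewrite eseries0; last by move=> k _ _; exact: nullN.
by rewrite lebesgue_measure_itv /= lte01 oppr0 adde0 lee_fin ler10.
Qed.

End NullSets.

(** * Words and stopping words *)

Section IteratedFunctionSystem.
Variables (R : realType) (L : finType) (Phi : L -> homothety R) (F : set R).
Hypotheses (ifsPhi : is_ifs Phi) (attrF : attractor Phi F).
Implicit Types (w : seq L) (phi : homothety R).

Let compactF : compact F. Proof. by case: attrF. Qed.
Let neF : F !=set0. Proof. by case: attrF. Qed.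
Let F_eq : F = \bigcup_(i in [set: L]) (Phi i @` F). Proof. by case: attrF. Qed.

Lemma word_ratio_gt0 w : 0 < word_ratio Phi w.
Proof. by apply: prodr_gt0 => i _; exact: ratio_gt0. Qed.

Definition word_homothety w := Homothety (word_map Phi w 0) (word_ratio_gt0 w).

Lemma word_homothetyE w : word_homothety w = word_map Phi w :> (R -> R).
Proof.
apply/funext => y; rewrite /homothety_fun /= /word_ratio.
elim: w => [|i w IH] /=; first by rewrite big_nil mul1r addr0.
by rewrite big_cons -IH /homothety_fun; ring.
Qed.

Lemma word_map_cat w1 w2 y :
  word_map Phi (w1 ++ w2) y = word_map Phi w1 (word_map Phi w2 y).
Proof. by elim: w1 => //= i w1 ->. Qed.

Lemma attractor_letter i y : F y -> F (Phi i y).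
Proof. by rewrite {2}F_eq => Fy; exists i => //; exists y. Qed.

Lemma attractor_preimage y : F y -> exists i z, F z /\ Phi i z = y.
Proof. by rewrite {1}F_eq => -[i _ [z]]; exists i, z. Qed.

Lemma attractor_word w y : F y -> F (word_map Phi w y).
Proof. by elim: w => //= i w IH /IH; exact: attractor_letter. Qed.

Lemma attractor_coding n y : F y ->
  exists w, size w = n /\ (word_map Phi w @` F) y.
Proof.
elim: n y => [|n IH] y Fy; first by exists [::]; split => //; exists y.
have [i [z [/IH[w [<- [t Ft <-]]] <-]]] := attractor_preimage Fy.
by exists (i :: w); split => //; exists t.
Qed.

Lemma ratio_bounds : exists rmin rmax,
  [/\ 0 < rmin, rmax < 1 & forall i, rmin <= ratio (Phi i) <= rmax].
Proof.
have [/card_gt0P[i0 _] ctr] := ifsPhi.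
case: (@arg_minP _ R L i0 xpredT (fun i => ratio (Phi i)) isT) => i _ imin.
case: (@arg_maxP _ R L i0 xpredT (fun i => ratio (Phi i)) isT) => j _ jmax.
exists (ratio (Phi i)), (ratio (Phi j)); split; [exact: ratio_gt0|exact: ctr|].
by move=> k; apply/andP; split; [exact: imin | exact: jmax].
Qed.

(** About its fixed point, [phi] is the scaling that sends [z] to [e + ratio phi * (z - e)]; the
    claim follows by iteration. *)
Lemma fixed_point_scaling phi e m y : (forall z, F z -> F (phi z)) ->
  phi e = e -> F y -> F (e + ratio phi ^+ m * (y - e)).
Proof.
move=> Fphi phie Fy; elim: m => [|m IH]; first by rewrite mul1r addrC subrK.
have -> : e + ratio phi ^+ m.+1 * (y - e) = phi (e + ratio phi ^+ m * (y - e)).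
  by move: phie; rewrite exprS /homothety_fun; lra.
exact: Fphi.
Qed.

(** The minimum [a] is [Phi i y] for some [y >= a] in [F]. As [Phi i] is increasing, [Phi i a <= a],
    and [Phi i a] cannot lie below the minimum. *)
Lemma attractor_min : exists a i, [/\ F a, forall y, F y -> a <= y & Phi i a = a].
Proof.
have [|a + amin] := compact_EVT_min neF compactF (f := id).
  by apply: continuous_subspaceT => ?; exact: cvg_id.
rewrite inE => Fa; have {}amin y : F y -> a <= y.
  by move=> Fy; apply: amin; rewrite inE.
have [i [y [Fy ya]]] := attractor_preimage Fa; exists a, i; split => //.
apply/eqP; rewrite eq_le (amin _ (attractor_letter i Fa)) andbT -{2}ya.
by rewrite -subr_ge0 homothety_sub mulr_ge0 ?subr_ge0 ?amin// ltW// ratio_gt0.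
Qed.

Lemma attractor_max : exists b i, [/\ F b, forall y, F y -> y <= b & Phi i b = b].
Proof.
have [|b + bmax] := compact_EVT_max neF compactF (f := id).
  by apply: continuous_subspaceT => ?; exact: cvg_id.
rewrite inE => Fb; have {}bmax y : F y -> y <= b.
  by move=> Fy; apply: bmax; rewrite inE.
have [i [y [Fy yb]]] := attractor_preimage Fb; exists b, i; split => //.
apply/eqP; rewrite eq_le (bmax _ (attractor_letter i Fb)) /= -{1}yb.
by rewrite -subr_ge0 homothety_sub mulr_ge0 ?subr_ge0 ?bmax// ltW// ratio_gt0.
Qed.

(** Before the last letter the ratio exceeds [rho], and that letter multiplies it by at least
    [rmin]. *)
Lemma stopping_word_ratio rmin rho w : 0 < rmin ->
  (forall i, rmin <= ratio (Phi i)) -> stopping_words Phi rho w ->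
  rmin * rho < word_ratio Phi w <= rho.
Proof.
move=> r0 rminP [+ -> +]; rewrite andbT; case/lastP: w => // w i _.
rewrite size_rcons /= -cats1 take_size_cat// /word_ratio big_cat big_seq1 /=.
move=> lt; rewrite mulrC.
apply: (@lt_le_trans _ _ (rmin * \prod_(i <- w) ratio (Phi i))).
  by rewrite mulrC ltr_pM2l.
by rewrite mulrC ler_pM2l//; exact: word_ratio_gt0.
Qed.

(** A long coding word of [y] has ratio at most [rho]; its shortest prefix with this property is a
    stopping word. This prefix is non-empty because the empty word has ratio [1 > rho]. *)
Lemma stopping_coding rho y : 0 < rho -> rho < 1 -> F y ->
  exists2 w, stopping_words Phi rho w & (word_map Phi w @` F) y.
Proof.
move=> rho0 rho1 Fy; have [rmin [rmax [r0 r1 rb]]] := ratio_bounds.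
have [/card_gt0P[i0 _] _] := ifsPhi.
have rmax0 : 0 < rmax.
  by have /andP[lo hi] := rb i0; apply: lt_le_trans hi; exact: lt_le_trans lo.
have [n rn] : exists n, rmax ^+ n <= rho.
  have /cvgrPdist_le /(_ rho rho0) : rmax ^+ n @[n --> \oo] --> 0.
    by apply: cvg_expr; rewrite gtr0_norm.
  move=> [n _ /(_ n (leqnn n))] /=.
  by rewrite sub0r normrN gtr0_norm ?exprn_gt0//; exists n.
have [w [sw [z Fz wz]]] := attractor_coding n Fy.
have ratio_w v : word_ratio Phi v <= rmax ^+ size v.
  elim: v => [|i v IH]; first by rewrite /word_ratio big_nil.
  rewrite /word_ratio big_cons exprS ler_pM ?(ltW (ratio_gt0 _))//.
    exact/ltW/word_ratio_gt0.
  by have /andP[] := rb i.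
have : exists k, (k <= n)%N && (word_ratio Phi (take k w) <= rho).
  exists n; rewrite leqnn /= -sw take_size; apply: le_trans rn.
  by rewrite -sw ratio_w.
move=> /ex_minnP[k /andP[kn kr] kmin]; exists (take k w); last first.
  exists (word_map Phi (drop k w) z); first exact: attractor_word.
  by rewrite -word_map_cat cat_take_drop.
case: k => [|k] in kn kr kmin *.
  by move: kr; rewrite take0 /word_ratio big_nil leNgt rho1.
have sk : size (take k.+1 w) = k.+1 by rewrite size_takel// sw.
split; [by rewrite -size_eq0 sk | by []|].
rewrite sk /= take_takel// ltNge; apply/negP => kr'.
by have := kmin k; rewrite kr' (ltnW kn) ltnn => /(_ isT).
Qed.

End IteratedFunctionSystem.

(** * Weakly homogeneous attractors satisfy the WSC *)

Section WeakSeparation.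
Variables (R : realType) (L : finType) (Phi : L -> homothety R) (F : set R).
Hypotheses (ifsPhi : is_ifs Phi) (attrF : attractor Phi F).

(* A word is located, up to [delta * rho], by the cell of a grid containing the
   images of the end points [a] and [b] of [F]; there are at most [N.*2.+1 ^ 2]
   cells within reach of a ball of radius [rho]. *)
Lemma weak_separation_of_isolated eps : 0 < eps ->
  (forall w w', let p := word_map Phi w in let q := word_map Phi w' in
     (forall y, F y -> `|q y - p y| <= eps * word_ratio Phi w) ->
     (forall y, F y -> `|q y - p y| <= eps * word_ratio Phi w') -> p = q) ->
  weak_separation Phi F.
Proof.
move=> eps0 isolated.
have [rmin [rmax [r0 _ rb]]] := ratio_bounds ifsPhi.
have {rb rmax} rb i : rmin <= ratio (Phi i) by have /andP[] := rb i.
have [a [_ [Fa amin _]]] := attractor_min attrF.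
have [b [_ [Fb bmax _]]] := attractor_max attrF.
(* Stopping words have ratio above [rmin * rho], so [delta * rho] is below [eps] times their
   ratio. *)
pose delta := eps * rmin; have d0 : 0 < delta by rewrite mulr_gt0.
(* An image that meets the ball has diameter at most [rho * (b - a)], so its end points are within
   [N] cells of width [delta * rho] from [x]. *)
pose N := (Num.truncn ((1 + (b - a)) / delta)).+1.
have NP : (1 + (b - a)) / delta < N%:R by rewrite truncnS_gt.
exists (N.*2.+1 * N.*2.+1)%N => rho x rho0.
have dr0 : 0 < delta * rho by rewrite mulr_gt0.
set S := [set _ | _ in _].
(* The count is of sets, not of words: [W] picks one word for each set in [S], and is arbitrary
   elsewhere. *)
have /choice[W WP] : forall A : set R, exists w, S A ->
    [/\ stopping_words Phi rho w, (word_map Phi w @` F) `&` ball x rho !=set0 &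
        word_map Phi w @` F = A].
  move=> A; have [[w [sw hit] wA]|nS] := pselect (S A); last by exists [::].
  by exists w.
(* The shift by [N] makes [u] non-negative on the relevant points, so that truncation is the
   floor. *)
pose u A t := (word_map Phi (W A) t - x) / (delta * rho) + N%:R.
pose cell A t := Num.truncn (u A t).
have u_bound A t : S A -> F t -> 0 <= u A t <= (N.*2)%:R.
  move=> /WP[sw [_ [[s Fs <-]]] + _] Ft; rewrite /ball /= => xs.
  have /andP[_ wr] := stopping_word_ratio r0 rb sw.
  have : `|word_map Phi (W A) t - x| <= rho * (1 + (b - a)).
    have -> : word_map Phi (W A) t - x = word_map Phi (W A) t -
       word_map Phi (W A) s + (word_map Phi (W A) s - x) by ring.
    apply: (le_trans (ler_normD _ _)); rewrite mulrDr mulr1 addrC lerD//.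
      by rewrite distrC ltW.
    rewrite -!word_homothetyE homothety_sub normrM gtr0_norm ?word_ratio_gt0//.
    apply: ler_pM => //; first exact/ltW/word_ratio_gt0.
    rewrite ler_norml; have := amin _ Fs; have := amin _ Ft.
    by have := bmax _ Fs; have := bmax _ Ft; lra.
  have le1 : rho * (1 + (b - a)) <= N%:R * (delta * rho).
    have -> : rho * (1 + (b - a)) = (1 + (b - a)) / delta * (delta * rho).
      by field; rewrite gt_eqF.
    by rewrite ler_pM2r// ltW.
  move=> /le_trans/(_ le1) bound.
  have : `|(word_map Phi (W A) t - x) / (delta * rho)| <= N%:R.
    by rewrite normrM normfV (gtr0_norm dr0) ler_pdivrMr.
  by rewrite ler_norml /u -mul2n natrM => /andP[lo hi]; lra.
have cell_lt A t : S A -> F t -> (cell A t < N.*2.+1)%N.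
  move=> SA Ft; have /andP[lo hi] := u_bound _ _ SA Ft.
  by rewrite ltnS truncn_le_nat (le_lt_trans hi)// ltr_nat.
have cell_close A B t : S A -> S B -> F t -> cell A t = cell B t ->
    `|word_map Phi (W B) t - word_map Phi (W A) t| <= delta * rho.
  move=> SA SB Ft cAB.
  have /andP[/truncn_itv/andP[loA hiA] _] := u_bound _ _ SA Ft.
  have /andP[/truncn_itv/andP[loB hiB] _] := u_bound _ _ SB Ft.
  have -> : word_map Phi (W B) t - word_map Phi (W A) t =
      (u B t - u A t) * (delta * rho).
    by rewrite /u; field; rewrite !gt_eqF.
  rewrite normrM (gtr0_norm dr0) ler_piMl ?(ltW dr0)// ler_norml.
  by move: loA hiA loB hiB; rewrite -/(cell A t) -/(cell B t) cAB -natr1; lra.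
apply/pcard_leP/injfunPex.
(* The two cells are the digits of a number in base [N.*2.+1]. *)
exists (fun A => (cell A a * N.*2.+1 + cell A b)%N).
  move=> A SA /=; apply: (@leq_trans (cell A a * N.*2.+1 + N.*2.+1)%N).
    by rewrite ltn_add2l cell_lt.
  by rewrite addnC -mulSn leq_mul2r cell_lt// orbT.
move=> A B; rewrite !inE => SA SB eqAB.
have eqb : cell A b = cell B b.
  have : (cell A a * N.*2.+1 + cell A b = cell B a * N.*2.+1 + cell B b
    %[mod N.*2.+1])%N by rewrite eqAB.
  by rewrite !modnMDl !modn_small ?cell_lt.
have eqa : cell A a = cell B a.
  by move: eqAB; rewrite eqb => /addIn/eqP; rewrite eqn_pmul2r// => /eqP.
have [swA _ <-] := WP _ SA; have [swB _ <-] := WP _ SB.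
have close y : F y ->
    `|word_map Phi (W B) y - word_map Phi (W A) y| <= delta * rho.
  move=> Fy; rewrite -!word_homothetyE.
  have [ab|ba] := ltP a b.
    apply: (@homothety_dist_le _ _ _ a b) => //.
    - by rewrite amin//= bmax.
    - by rewrite !word_homothetyE; exact: cell_close.
    - by rewrite !word_homothetyE; exact: cell_close.
  have -> : y = a by apply/eqP; rewrite eq_le amin// (le_trans (bmax _ Fy)).
  by rewrite !word_homothetyE; exact: cell_close.
have rhoE C : S C -> delta * rho <= eps * word_ratio Phi (W C).
  move=> /WP[sw _ _]; have /andP[wr _] := stopping_word_ratio r0 rb sw.
  by rewrite /delta -mulrA ler_pM2l// ltW.
congr (_ @` F); apply: isolated => y Fy; apply: le_trans (close _ Fy) _.
- exact: rhoE.
- exact: rhoE.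
Qed.

Lemma weakly_homogeneous_weak_separation : (hausdorff_dim F < 1)%E ->
  ~ (exists x, F = [set x]) -> weakly_homogeneous F -> weak_separation Phi F.
Proof.
move=> dimF nsing hom; apply: contrapT => nWSC.
have [a [i [Fa amin ai]]] := attractor_min attrF.
have [b [j [Fb bmax bj]]] := attractor_max attrF.
have r01 k : 0 < ratio (Phi k) < 1 by rewrite ratio_gt0; exact: ifsPhi.2.
have ab : a < b.
  rewrite lt_neqAle amin// andbT; apply/eqP => eab; apply: nsing; exists a.
  apply/seteqP; split => [y Fy|_ ->//] /=.
  by apply/eqP; rewrite eq_le amin// {1}eab bmax.
have cla m y : F y -> F (a + ratio (Phi i) ^+ m * (y - a)).
  by apply: fixed_point_scaling => // z; exact: (attractor_letter attrF).
have clb m y : F y -> F (b + ratio (Phi j) ^+ m * (y - b)).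
  by apply: fixed_point_scaling => // z; exact: (attractor_letter attrF).
have [||||kappa k0 progs] := @near_progression_exists _ F a b
    (ratio (Phi i)) (ratio (Phi j)) Fa Fb ab _ _ _ cla clb.
- by move=> y Fy; rewrite amin// bmax.
- exact: r01.
- exact: r01.
- move=> eps eps0; apply: contrapT => nclose; apply: nWSC.
  apply: (weak_separation_of_isolated eps0) => w w' p q le_w le_w'.
  apply: contrapT => pq; apply: nclose.
  exists (word_homothety Phi w), (word_homothety Phi w').
  rewrite !word_homothetyE; split => //.
  + by move=> y; exact: (attractor_word attrF).
  + by move=> y; exact: (attractor_word attrF).
have [|n [M_ [mini cover]]] := hom `[0, 1]%classic.
  exact: (unit_interval_microset Fa (r01 i) cla k0 progs).
exact: unit_interval_not_finite_union dimF mini cover.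
Qed.

End WeakSeparation.

(** * The WSC implies weak homogeneity *)

Lemma image_ultra (T U : Type) (f : T -> U) (G : set_system T) :
  UltraFilter G -> UltraFilter (f @ G).
Proof.
move=> GU; have GP := @ultra_proper _ _ GU.
split; first exact: fmap_proper_filter.
move=> H HP sub; apply/seteqP; split => // A HA.
have [//|GnA] := in_ultra_setVsetC (f @^-1` A) GU.
have : H set0 by rewrite -(setICr A); apply: filterI => //; exact: sub.
by move=> /filter_not_empty.
Qed.

Lemma compact_ultra_cvg (I : Type) (T : topologicalType) (G : set_system I)
    (A : set T) (u : I -> T) : UltraFilter G -> compact A ->
  (forall i, A (u i)) -> exists2 l, A l & u @ G --> l.
Proof.
move=> GU; rewrite compact_ultra /= => cA Au.
have GP := @ultra_proper _ _ GU.
have uGA : (u @ G) A by change (G (u @^-1` A)); exact: filterE.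
by have [l [Al ul]] := cA _ (image_ultra u GU) uGA; exists l.
Qed.

(** Otherwise the complements of all fibres lie in [G], and so does their finite intersection, which
    is empty. *)
Lemma ultra_finite_cover (I : Type) (J : finType) (G : set_system I)
    (f : I -> J) : UltraFilter G -> exists j, G [set i | f i = j].
Proof.
move=> GU; have GP := @ultra_proper _ _ GU.
apply: contrapT => no; apply: (@filter_not_empty _ G _).
have : \forall i \near G, forall j, f i <> j.
  apply: filter_forall => j.
  have [Gj|//] := in_ultra_setVsetC [set i | f i = j] GU.
  by case: no; exists j.
by apply: filterS => i /(_ (f i)); exact.
Qed.

Section WeakHomogeneity.
Variables (R : realType) (F : set R).
Implicit Types (K : set R) (phi psi : homothety R).

Lemma homothety_compact phi : compact F -> compact (phi @` F).
Proof.
move=> cF; apply: continuous_compact => //; apply: continuous_subspaceT => x.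
by apply: cvgD; [exact: cvgMr | exact: cvg_cst].
Qed.

Lemma finite_cover_microset K n (psi : 'I_n -> homothety R) : compact F ->
  compact K -> K !=set0 -> K `<=` `[0, 1] -> (forall j, expanding (psi j)) ->
  K `<=` \bigcup_j (psi j @` F) ->
  exists (n : nat) (M_ : 'I_n -> set R),
    (forall i, miniset F (M_ i)) /\ K = \bigcup_i M_ i.
Proof.
move=> cF cK [x0 Kx0] K01 expand cover; have [j0 _ Fx0] := cover _ Kx0.
pose P j := K `&` (psi j @` F).
have mini j : P j !=set0 -> miniset F (P j).
  move=> ne; split => //; last first.
    exists (psi j); split; first exact: expand.
    by move=> x [Kx Fx]; split => //; exact: K01.
  apply: compact_closedI => //; apply: compact_closed.
    exact: Rhausdorff.
  exact: homothety_compact.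
have P0 : P j0 !=set0 by exists x0.
(* Minisets are non-empty, so an empty piece is replaced by [P j0], which contains [x0]. *)
exists n, (fun j => if pselect (P j !=set0) then P j else P j0); split.
  by move=> j; case: pselect => [?|?]; exact: mini.
apply/seteqP; split => [x Kx|x [j _] /=].
  have [j _ Fx] := cover _ Kx; exists j => //.
  by case: pselect => // -[]; exists x.
by case: pselect => [?|?] [].
Qed.

(* Limits along an ultrafilter replace the extraction of subsequences. *)
Lemma microset_cover K (M_ : nat -> set R) c rmin
    (psi : nat -> 'I_c -> homothety R) : compact F -> 0 < rmin ->
  (forall n, miniset F (M_ n)) -> hausdorff_dist (M_ n) K @[n --> \oo] --> 0%E ->
  (forall n j, 1 <= ratio (psi n j) <= rmin^-1) ->
  (forall n j, exists2 y, F y & `|psi n j y - 1 / 2| <= rmin^-1) ->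
  (forall n, M_ n `<=` \bigcup_j (psi n j @` F)) ->
  K `<=` `[0, 1] /\
  exists psi' : 'I_c -> homothety R, (forall j, expanding (psi' j)) /\
    K `<=` \bigcup_j (psi' j @` F).
Proof.
move=> cF r0 mini hcvg ratio_psi shift_psi cover.
have [U [UU ooU]] := ultraFilterLemma (eventually_filter : ProperFilter \oo).
have UP := @ultra_proper _ _ UU.
have [B [_ /(_ (B + 1) ltac:(by rewrite ltrDl))FB]] := compact_bounded cF.
(* [C] bounds the shift, which is the value at [y] minus the ratio times [y]: for some [y] in [F]
   the value is within [rmin^-1] of [1 / 2], and [F] is bounded by [B + 1]. *)
pose C := 1 / 2 + rmin^-1 + rmin^-1 * (B + 1).
have shift_bound n j : `[- C, C]%classic (shift (psi n j)).
  have [y Fy yb] := shift_psi n j; rewrite /= in_itv /= -ler_norml.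
  have -> : shift (psi n j) = (1 / 2 + (psi n j y - 1 / 2)) - ratio (psi n j) * y.
    by rewrite /homothety_fun; ring.
  apply: (le_trans (ler_normB _ _)); rewrite lerD//.
    by apply: (le_trans (ler_normD _ _)); rewrite lerD// ger0_norm//; lra.
  have /andP[r1 r2] := ratio_psi n j.
  by rewrite normrM (gtr0_norm (ratio_gt0 _)) ler_pM ?(ltW (ratio_gt0 _))// FB.
have lim j : exists psi' : homothety R, [/\ expanding psi',
    ratio (psi n j) @[n --> U] --> ratio psi' &
    shift (psi n j) @[n --> U] --> shift psi'].
  have [|a + al] := @compact_ultra_cvg _ R _ `[1, rmin^-1]%classic
      (fun n => ratio (psi n j)) UU (@segment_compact R 1 rmin^-1).
    by move=> n; rewrite /= in_itv /= ratio_psi.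
  rewrite /= in_itv /= => /andP[a1 _].
  have [|b _ bl] := @compact_ultra_cvg _ R _ `[- C, C]%classic
      (fun n => shift (psi n j)) UU (@segment_compact R (- C) C).
    by move=> n.
  have a0 : 0 < a by apply: lt_le_trans a1.
  by exists (Homothety b a0).
have {lim}[psi' psi'P] := choice lim.
have key x : K x -> `[0, 1]%classic x /\ (\bigcup_j (psi' j @` F)) x.
  move=> Kx; pose h n := hausdorff_dist (M_ n) K.
  have [hfin hfine] : (\forall n \near \oo, h n \is a fin_num) /\
      fine \o h @ \oo --> (0 : R) by apply/fine_cvgP.
  (* The harmonic term gives the strict inequality needed to pick a point near an infimum. Where the
     distance is not finite, any point of [M_ n] is taken. *)
  have approx n : exists jy : 'I_c * R, [/\ F jy.2, M_ n (psi n jy.1 jy.2) &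
      h n \is a fin_num -> `|x - psi n jy.1 jy.2| <= fine (h n) + harmonic n].
    have [hn|hn] := boolP (h n \is a fin_num); last first.
      have [_ [m Mm] _] := mini n; have [j _ [y Fy ym]] := cover _ _ Mm.
      by exists (j, y); rewrite /= ym.
    have [|m Mm xm] := hausdorff_dist_lt (A := M_ n)
        (eps := fine (h n) + harmonic n) _ Kx.
      by rewrite EFinD fineK// -/(h n) lteDl// lte_fin harmonic_gt0.
    have [j _ [y Fy ym]] := cover _ _ Mm.
    by exists (j, y); rewrite /= ym; split => // _; exact: ltW.
  have {approx}[jy jyP] := choice approx.
  pose m n := psi n (jy n).1 (jy n).2.
  have mx : m @ U --> x.
    have : m @ \oo --> x.
      apply/cvgrPdist_le => e e0.
      have sum0 : fine (h n) + harmonic n @[n --> \oo] --> (0 : R).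
        rewrite -[0 in X in _ --> X]addr0.
        by apply: cvgD; [exact: hfine | exact: cvg_harmonic].
      move/cvgrPdist_le : sum0 => /(_ _ e0) le_e.
      near=> n.
      have [_ _] := jyP n; move=> /(_ _)/le_trans; apply; first by near: n.
      have : `|0 - (fine (h n) + harmonic n)| <= e by near: n.
      by rewrite sub0r normrN; apply: le_trans; exact: ler_norm.
    by apply: cvg_trans => A; exact: ooU.
  have m01 n : `[0, 1]%classic (m n).
    have [_ Mm _] := jyP n; have [_ _ [phi [_ sub]]] := mini n.
    by have [] := sub _ Mm.
  split.
    have [z z01 mz] := compact_ultra_cvg UU (@segment_compact R 0 1) m01.
    by rewrite (cvg_unique (@Rhausdorff R) mx mz).
  have [|y Fy yl] := @compact_ultra_cvg _ R _ F (fun n => (jy n).2) UU cF.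
    by move=> n; have [] := jyP n.
  (* The index may vary with [n], but one of its finitely many values is taken on a set of the
     ultrafilter. *)
  have [j Uj] := ultra_finite_cover (fun n => (jy n).1) UU.
  exists j => //; exists y => //.
  have [_ rl sl] := psi'P j.
  apply: (cvg_unique (@Rhausdorff R) _ mx).
  have : ratio (psi n j) * (jy n).2 + shift (psi n j) @[n --> U] --> psi' j y.
    by apply: cvgD => //; exact: cvgM.
  apply: cvg_trans; apply: near_eq_cvg.
  by apply: filterS Uj => n /= <-.
split; first by move=> x /key[].
exists psi'; split; first by move=> j; have [] := psi'P j.
by move=> x /key[].
Unshelve. all: by end_near.
Qed.

End WeakHomogeneity.

Section WeakSeparationCover.
Variables (R : realType) (L : finType) (Phi : L -> homothety R) (F : set R).
Hypotheses (ifsPhi : is_ifs Phi) (attrF : attractor Phi F).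

(* At scale [rho = 1 / (rmin * ratio phi)] the maps [phi \o word_map w], for
   stopping words [w], have ratios between [1] and [1 / rmin]. *)
Lemma miniset_cover rmin c : 0 < rmin -> rmin < 1 ->
  (forall i, rmin <= ratio (Phi i)) ->
  (forall (rho x : R), 0 < rho ->
    ([set word_map Phi w @` F | w in [set w | stopping_words Phi rho w /\
      (word_map Phi w @` F) `&` ball x rho !=set0]] #<= `I_c)%card) ->
  forall M, miniset F M -> exists psi : 'I_c.+1 -> homothety R,
    [/\ forall j, 1 <= ratio (psi j) <= rmin^-1,
        forall j, exists2 y, F y & `|psi j y - 1 / 2| <= rmin^-1 &
        M `<=` \bigcup_j (psi j @` F)].
Proof.
move=> r0 r1 rb wsc M [_ [m0 Mm0] [phi [expand MF]]].
have p0 := ratio_gt0 phi; pose rho := (rmin * ratio phi)^-1.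
have rho0 : 0 < rho by rewrite invr_gt0 mulr_gt0.
have rhoE : ratio phi * rho = rmin^-1 by rewrite /rho; field; rewrite !gt_eqF.
have ri1 : 1 < rmin^-1 by rewrite invf_gt1.
have near_half m : M m -> `|m - 1 / 2| <= 1 / 2.
  by move=> /MF[/= + _]; rewrite in_itv /= ler_norml => /andP[? ?]; lra.
(* If [rho >= 1], then [ratio phi <= rmin^-1] and [phi] alone covers [M]. The index type ['I_c.+1]
   contains [ord0] even for [c = 0]. *)
have [rho1|rho1] := leP 1 rho.
  exists (fun=> phi); split => [_|_|m Mm].
  - by rewrite -rhoE [1 <= _]expand ler_peMr// ltW.
  - have [_ [y Fy ym]] := MF _ Mm0; exists y => //; rewrite ym.
    by apply: le_trans (near_half _ Mm0) _; lra.
  - by have [_ Fm] := MF _ Mm; exists ord0.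
(* [phi] maps the ball of radius [rho] about [x] onto the ball of radius [rmin^-1 > 1] about
   [1 / 2], which contains the unit interval. *)
pose x := (1 / 2 - shift phi) / ratio phi.
have phix : phi x = 1 / 2 by rewrite /x /homothety_fun; field; rewrite gt_eqF.
pose hits w := stopping_words Phi rho w /\
  (word_map Phi w @` F) `&` ball x rho !=set0.
have /pcard_leP/injfunPex[g gc ginj] := wsc rho x rho0.
pose comp w : homothety R := Homothety (phi (word_map Phi w 0))
  (mulr_gt0 p0 (word_ratio_gt0 Phi w)).
have compE w y : comp w y = phi (word_map Phi w y).
  by rewrite -word_homothetyE /comp /homothety_fun /=; ring.
have good w : hits w -> 1 <= ratio (comp w) <= rmin^-1 /\
    exists2 y, F y & `|comp w y - 1 / 2| <= rmin^-1.
  move=> [sw [_ [[y Fy <-] xy]]]; split => /=.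
    have /andP[lo hi] := stopping_word_ratio r0 rb sw.
    rewrite -rhoE ler_pM2l// hi andbT; apply/ltW; move: lo.
    by rewrite -(ltr_pM2l p0) mulrCA rhoE divff// gt_eqF.
  exists y => //; rewrite compE -phix homothety_sub normrM gtr0_norm//.
  by rewrite -rhoE ler_pM2l// distrC ltW.
have code m : M m -> exists2 w, hits w & (phi @` (word_map Phi w @` F)) m.
  move=> Mm; have [_ [y Fy ym]] := MF _ Mm.
  have [w sw wy] := stopping_coding ifsPhi attrF rho0 rho1 Fy.
  exists w; last by exists y.
  split => //; exists y; split => //.
  rewrite /ball /= -(ltr_pM2l p0) rhoE -{1}(gtr0_norm p0) -normrM.
  rewrite -homothety_sub phix ym distrC.
  by apply: le_lt_trans (near_half _ Mm) _; lra.
have [w0 hw0 _] := code _ Mm0.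
(* Words with the same image of [F] cover the same points, so one word for each value of the
   numbering [g] suffices; values that are not attained get [w0]. *)
have pick (j : 'I_c.+1) : exists w, hits w /\
    forall w', hits w' -> g (word_map Phi w' @` F) = j ->
      word_map Phi w' @` F = word_map Phi w @` F.
  have [[w [hw gw]]|no] :=
      pselect (exists w, hits w /\ g (word_map Phi w @` F) = j).
    exists w; split => // w' hw' gw'; apply: ginj; rewrite ?inE.
    - by exists w'.
    - by exists w.
    - by rewrite gw gw'.
  by exists w0; split => // w' hw' gw'; case: no; exists w'.
have [W WP] := choice pick.
exists (fun j => comp (W j)); split => [j|j|m Mm].
- by have [/good[]] := WP j.
- by have [/good[]] := WP j.
have [w hw [y wy <-]] := code _ Mm.
have gw : (g (word_map Phi w @` F) < c)%N by apply: gc; exists w.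
pose j := Ordinal (ltnW gw : (_ < c.+1)%N).
have [_ /(_ w hw erefl) eqw] := WP j.
exists j => //; have : (word_map Phi (W j) @` F) y by rewrite -eqw.
by move=> [z Fz <-]; exists z => //; rewrite compE.
Qed.

Lemma weak_separation_weakly_homogeneous :
  weak_separation Phi F -> weakly_homogeneous F.
Proof.
move=> [c wsc] K [cK K0 [M_ [mini hcvg]]].
have [cF _ _] := attrF.
have [[/card_gt0P[i0 _] _] [rmin [rmax [r0 r1 rb]]]] :=
  (ifsPhi, ratio_bounds ifsPhi).
have {}r1 : rmin < 1.
  by have /andP[lo hi] := rb i0; exact: le_lt_trans (le_trans lo hi) r1.
have {rb rmax} rb i : rmin <= ratio (Phi i) by have /andP[] := rb i.
have [psi psiP] := choice (fun n => miniset_cover r0 r1 rb wsc (mini n)).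
have [K01 [psi' [expand cover]]] : K `<=` `[0, 1]%classic /\
    exists psi' : 'I_c.+1 -> homothety R, (forall j, expanding (psi' j)) /\
      K `<=` \bigcup_j (psi' j @` F).
  by apply: (microset_cover cF r0 mini hcvg (psi := psi)) => n;
    have [] := psiP n.
exact: finite_cover_microset cF cK K0 K01 expand cover.
Qed.

End WeakSeparationCover.

Theorem theorem5p10 (R : realType) (L : finType) (Phi : L -> homothety R)
    (F : set R) (ifsPhi : is_ifs Phi) (attrF : attractor Phi F)
    (dimF : (hausdorff_dim F < 1)%E) (nsingF : ~ exists x : R, F = [set x]) :
  weakly_homogeneous F <-> weak_separation Phi F.
Proof.
split; first exact: weakly_homogeneous_weak_separation.
exact: weak_separation_weakly_homogeneous.
Qed.
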